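(* Let $X$ be an infinite-dimensional Banach space and let $\Lambda\leq X$ be a cobounded lattice, and consider the Diophantine space $(X,\mathbb{Q}\Lambda,H_{\mathrm{std}})$. Fix $\varepsilon>0$. For every $x\in X$ and for every $q\in\mathbb{N}$, there exists $p\in\Lambda$ such that $$\left\|x-\frac{p}{q}\right\|\leq\frac{\mathrm{codiam}(\Lambda)+\varepsilon}{q}.$$ In particular, the function $\psi_1(q)=1/q$ is uniformly Dirichlet, and in fact, $\psi_1$ is optimal.
   Context: Banach spaces are real; $\mathbb{N}=\{1,2,\ldots\}$. A lattice in a Banach space $X$ is a subgroup $\Lambda\leq X$ which is topologically discrete (equivalently $\min_{p\in\Lambda\setminus\{0\}}\|p\|>0$) and such that $\mathbb{R}\Lambda$ is dense in $X$, or equivalently, no proper closed subspace of $X$ contains $\Lambda$. $\Lambda$ is cobounded if its codiameter $\mathrm{codiam}(\Lambda):=\sup\{\mathrm{dist}(x,\Lambda):x\in X\}$ is finite. $\mathbb{Q}\Lambda=\{p/q:p\in\Lambda,q\in\mathbb{N}\}$, and $H_{\mathrm{std}}(r)=\min\{q\in\mathbb{N}:qr\in\Lambda\}$ for $r\in\mathbb{Q}\Lambda$. A function $\psi:(0,+\infty)\to(0,+\infty)$ is a Dirichlet function if for every $x\in X$ there exist $C_x>0$ and a sequence $(r_n)_{n\ge1}$ in $\mathbb{Q}\Lambda$ such that $r_n\to x$ and $\|x-r_n\|\leq C_x\,\psi(H_{\mathrm{std}}(r_n))$ for all $n$; it is uniformly Dirichlet if $C_x$ can be chosen independent of $x$.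 A Dirichlet function $\psi$ is optimal if there is no Dirichlet function $\phi:(0,+\infty)\to(0,+\infty)$ with $\frac{\phi(q)}{\psi(q)}\to 0$ as $q\to+\infty$. *)

(* Defs.v *)
From HB Require Import structures.
From mathcomp Require Import all_boot all_order all_algebra.
From mathcomp Require Import all_classical all_reals all_analysis.

Set Implicit Arguments.
Unset Strict Implicit.
Unset Printing Implicit Defensive.

Import Order.TTheory GRing.Theory Num.Theory.
Import numFieldNormedType.Exports.

Local Open Scope classical_set_scope.
Local Open Scope ring_scope.

Section LinearSpan.
Context {R : realType} {X : lmodType R}.

Definition linspan (A : set X) : set X :=
  [set x | exists n (c : 'I_n -> R) (v : 'I_n -> X),
     (forall i, A (v i)) /\ x = \sum_(i < n) c i *: v i].

End LinearSpan.

Definition infinite_dimensional (R : realType) (X : lmodType R) : Prop :=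
  ~ exists2 B : set X, finite_set B & linspan B = setT.

Section Lattices.
Context {R : realType} {X : completeNormedModType R}.
Implicit Type L : set X.

(* "RΛ is dense" refers to the real linear span of Λ: this is the reading under
   which it means that no proper closed subspace contains Λ. *)
Definition lattice L : Prop :=
  [/\ GRing.zmod_closed (mem L), isolated L = L & dense (linspan L)].

(* On a normed module, edist (x, p) is `|x - p|%:E, so edist_inf L x is
   dist(x, Λ). *)
Definition codiam L : \bar R := ereal_sup (range (edist_inf L)).

Definition cobounded L : Prop := (codiam L < +oo)%E.

Definition rational_points L : set X :=
  [set r | exists (p : X) (q : nat), [/\ L p, (0 < q)%N & r = q%:R^-1 *: p]].

(* Only meaningful on rational_points L; elsewhere the minimum does not exist
   and get returns a default value. *)
Definition std_height L (r : X) : nat :=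
  [get q : nat | [/\ (0 < q)%N, L (q%:R *: r)
     & forall m : nat, (0 < m)%N -> L (m%:R *: r) -> (q <= m)%N]].

End Lattices.

(* A Diophantine space (X, Q, H) is given by a set Q of "rational points" of X
   and a height H, whose values outside Q are irrelevant.  Functions from
   (0, +oo) to (0, +oo) are represented by functions on R which are positive at
   positive arguments; their other values are irrelevant, too. *)
Section Dirichlet.
Context {R : realType} {X : completeNormedModType R}.
Variables (Q : set X) (H : X -> nat).
Implicit Types phi psi : R -> R.

Definition pos_fun psi : Prop := forall t : R, 0 < t -> 0 < psi t.

Definition approximable psi (C : R) (x : X) : Prop :=
  exists r : nat -> X, [/\ forall n, Q (r n), r n @[n --> \oo] --> x
    & forall n, `|x - r n| <= C * psi (H (r n))%:R].

Definition dirichlet psi : Prop :=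
  pos_fun psi /\ forall x : X, exists2 C : R, 0 < C & approximable psi C x.

Definition uniformly_dirichlet psi : Prop :=
  pos_fun psi /\ exists2 C : R, 0 < C & forall x : X, approximable psi C x.

Definition optimal psi : Prop :=
  dirichlet psi /\
  ~ exists2 phi : R -> R, dirichlet phi & phi q / psi q @[q --> +oo] --> 0.

End Dirichlet.

(* Main.v *)
Require Import Defs.
From HB Require Import structures.
From mathcomp Require Import all_boot all_order all_algebra.
From mathcomp Require Import all_classical all_reals all_analysis.
From mathcomp Require Import lra.

Set Implicit Arguments.
Unset Strict Implicit.
Unset Printing Implicit Defensive.

Import Order.TTheory GRing.Theory Num.Theory.
Import numFieldNormedType.Exports.

Local Open Scope classical_set_scope.
Local Open Scope ring_scope.

(** The approximation property is the definition of the codiameter applied to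
    [q x]: some lattice point [p] lies within [codiam L + eps] of [q x], and one
    divides by [q].  As the reduced denominator of [p / q] is at most [q], taking
    [q = 1, 2, ...] shows that [1 / q] is uniformly Dirichlet.

    Optimality rests on the existence of a badly approximable point: some [x]
    and [c > 0] such that [q x] has distance at least [c] to the lattice for
    every [q > 0] ([exists_badly_approximable]).  At such a point any rational
    [r] of height [h] satisfies [c <= h |x - r|].  Hence rationals converging to
    [x] have heights tending to infinity, and if they satisfy
    [|x - r| <= C phi h] then [h phi h >= c / C], so that [phi h / h^-1] does
    not tend to [0].

    This is where infinite dimension is needed.  Let [m] be a lower bound of the
    norms of nonzero lattice points.  The point [x] is the sum of steps of norm
    [a / 2^k], with [a = m / 16].  The step number [k] takes care of the
    denominators [q] between [2^k] and [2^(k+1)]: multiplied by [q] it has norm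
    at least [a], while the sum of all later steps multiplied by [q] stays below
    [m / 4].  For each [q < 2^(k+1)] at most one lattice point [p] is closer
    than [m / 2] to [q S], where [S] is the current partial sum; there are thus
    finitely many vectors [q S - p] of norm less than [m / 2], and the direction
    [u] of the new step is chosen with [|q S - p + t u| >= |q S - p|] for each
    of them and all [t].  Such a step never shortens a short vector, and by the
    triangle inequality it makes the vector at least half as long as the step.
    A vector which has once reached length [m / 2] cannot become short again,
    because the remaining steps are too small.

    The direction [u] is found with norming functionals
    ([hahn_banach_norming]): if [f] is linear, [f <= |.|] and [f v = |v|], then
    [|v + t u| >= f (v + t u) = |v|] whenever [f u = 0]; and finitely many
    functionals on an infinite-dimensional space have a common nonzero zero
    ([common_kernel_neq0]).  The norming functional is a minimal element, given
    by Zorn's lemma, among the sublinear functionals below the norm. *)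

(** * Norming functionals *)

Lemma le_add_inf (R : realType) (A B : set R) (z : R) :
  A !=set0 -> B !=set0 -> (forall a b, A a -> B b -> z <= a + b) ->
  z <= inf A + inf B.
Proof.
move=> A0 B0 zAB; rewrite -lerBlDr; apply: lb_le_inf => // a Aa.
rewrite lerBlDr addrC -lerBlDr; apply: lb_le_inf => // b Bb.
by rewrite lerBlDr addrC; exact: zAB.
Qed.

Lemma le_pmul_inf (R : realType) (A : set R) (t z : R) :
  0 < t -> A !=set0 -> (forall a, A a -> z <= t * a) -> z <= t * inf A.
Proof.
move=> t0 A0 zA; rewrite -ler_pdivrMl //; apply: lb_le_inf => // a Aa.
by rewrite ler_pdivrMl //; exact: zA.
Qed.

Section HahnBanach.
Context {R : realType} {X : lmodType R}.
Implicit Types p q : X -> R.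

Definition sublinear p : Prop :=
  (forall x y, p (x + y) <= p x + p y) /\
  (forall t x, 0 < t -> p (t *: x) <= t * p x).

Lemma sublinearZ p t x : sublinear p -> 0 < t -> p (t *: x) = t * p x.
Proof.
move=> [_ pZ] t0; apply/eqP; rewrite eq_le pZ //=.
have := pZ t^-1 (t *: x); rewrite invr_gt0 => /(_ t0).
by rewrite scalerA mulVf ?gt_eqF // scale1r ler_pdivlMl.
Qed.

Lemma sublinear0 p : sublinear p -> p 0 = 0.
Proof.
move=> sp; have := sublinearZ 0 sp (ltr0n _ 2); rewrite scaler0; lra.
Qed.

Lemma sublinear_ge p x : sublinear p -> - p (- x) <= p x.
Proof.
move=> sp; have := sp.1 x (- x); rewrite subrr sublinear0 //; lra.
Qed.

(** Sliding [x] along the ray spanned by [y] can only decrease a sublinear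
    functional, and makes it linear along [y]. *)
Definition slide p (y x : X) : R :=
  inf [set p (x + t *: y) - t * p y | t in [set t : R | 0 <= t]].

Lemma slide_le p y x t : sublinear p -> 0 <= t ->
  slide p y x <= p (x + t *: y) - t * p y.
Proof.
move=> sp t0; apply: ge_inf; last by exists t.
exists (- p (- x)) => _ [s /= s0 <-].
have ps : p (s *: y) = s * p y.
  have [->|sn0] := eqVneq s 0; first by rewrite scale0r mul0r sublinear0.
  by rewrite sublinearZ // lt_neqAle eq_sym sn0.
have := sp.1 (x + s *: y) (- x).
by rewrite addrC addKr ps; lra.
Qed.

Lemma slide_le_id p y x : sublinear p -> slide p y x <= p x.
Proof.
by move=> sp; have := slide_le y x sp (lexx 0); rewrite scale0r addr0 mul0r subr0.
Qed.

Lemma slide_opp p y : sublinear p -> slide p y (- y) <= - p y.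
Proof.
move=> sp; have := slide_le y (- y) sp ler01.
by rewrite scale1r addNr sublinear0 // mul1r sub0r.
Qed.

Lemma slide_sublinear p y : sublinear p -> sublinear (slide p y).
Proof.
move=> sp; have ne x : [set p (x + t *: y) - t * p y | t in [set t : R | 0 <= t]]
    !=set0 by exists (p (x + 0 *: y) - 0 * p y); exists 0 => /=.
split=> [x1 x2|t x t0].
  apply: le_add_inf => // _ _ [s /= s0 <-] [t /= t0 <-].
  apply: le_trans (slide_le _ _ sp (addr_ge0 s0 t0)) _.
  by have := sp.1 (x1 + s *: y) (x2 + t *: y); rewrite addrACA -scalerDl; lra.
apply: le_pmul_inf => // _ [s /= s0 <-].
apply: le_trans (slide_le _ _ sp (mulr_ge0 (ltW t0) s0)) _.
by rewrite -scalerA -scalerDr sublinearZ // mulrBr mulrA.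
Qed.

(** A chain of sublinear functionals has its pointwise infimum as a sublinear
    lower bound (the values at [x] stay above the bound [- q (- x)]), so Zorn's
    lemma applies. *)
Lemma minimal_sublinear q : sublinear q ->
  exists p, [/\ sublinear p, forall x, p x <= q x &
    forall p', sublinear p' -> (forall x, p' x <= p x) -> forall x, p x <= p' x].
Proof.
move=> sq; pose T := {p : X -> R | sublinear p /\ forall x, p x <= q x}.
pose ge (p1 p2 : T) := `[< forall x, sval p2 x <= sval p1 x >].
pose q0 : T := exist _ q (conj sq (fun x => lexx _)).
have ge_refl t : ge t t by apply/asboolP.
have ge_trans r s t : ge r s -> ge s t -> ge r t.
  by move=> /asboolP rs /asboolP st; apply/asboolP => x; exact: le_trans (rs x).
have [A Atot|[p [sp pq]] pmin] := ZL_preorder q0 ge_refl ge_trans; last first.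
  exists p; split=> // p' sp' p'p.
  have p'q x : p' x <= q x by exact: le_trans (pq x).
  pose t' : T := exist _ p' (conj sp' p'q).
  by have /asboolP := pmin t' (introT (asboolP _) p'p).
have [A0|A0] := pselect (A !=set0); last first.
  by exists q0 => s As; case: A0; exists s.
pose V x := [set sval s x | s in A].
have V0 x : V x !=set0 by have [s As] := A0; exists (sval s x); exists s.
have Vlb x s : A s -> inf (V x) <= sval s x.
  move=> As; apply: ge_inf; last by exists s.
  exists (- q (- x)) => _ [r Ar <-]; have [sr rq] := svalP r.
  by apply: le_trans (sublinear_ge x sr); rewrite lerN2.
have sinf : sublinear (fun x => inf (V x)).
  split=> [x y|t x t0].
    apply: le_add_inf => // _ _ [r Ar <-] [s As <-].
    have [/asboolP rs|/asboolP sr] := Atot _ _ Ar As.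
      apply: le_trans (Vlb _ _ As) _; apply: le_trans ((svalP s).1.1 _ _) _.
      by rewrite lerD2r.
    apply: le_trans (Vlb _ _ Ar) _; apply: le_trans ((svalP r).1.1 _ _) _.
    by rewrite lerD2l.
  apply: le_pmul_inf => // _ [r Ar <-].
  by apply: le_trans (Vlb _ _ Ar) _; exact: (svalP r).1.2.
have infq x : inf (V x) <= q x.
  have [s As] := A0; exact: le_trans (Vlb x s As) ((svalP s).2 x).
exists (exist _ (fun x => inf (V x)) (conj sinf infq)) => s As.
by apply/asboolP => x; exact: Vlb.
Qed.

(** For minimal [p] and any [y], minimality gives [p <= slide p y]; at [- y]
    this reads [p (- y) <= - p y], hence [p] is odd, and an odd sublinear
    functional is linear. *)
Lemma minimal_sublinear_scalar p : sublinear p ->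
  (forall p', sublinear p' -> (forall x, p' x <= p x) -> forall x, p x <= p' x) ->
  scalar p.
Proof.
move=> sp pmin.
have pN y : p (- y) = - p y.
  apply/eqP; rewrite eq_le; apply/andP; split.
    apply: le_trans (slide_opp y sp); apply: pmin; first exact: slide_sublinear.
    by move=> x; exact: slide_le_id.
  by have := sublinear_ge (- y) sp; rewrite opprK.
have pD x y : p (x + y) = p x + p y.
  apply/eqP; rewrite eq_le sp.1 /=.
  by have := sp.1 (- x) (- y); rewrite -opprD !pN; lra.
move=> a u v; rewrite pD; congr (_ + _).
have [a0|a0|->] := ltgtP a 0; last by rewrite scale0r mul0r sublinear0.
  rewrite -[a]opprK scaleNr pN sublinearZ ?oppr_gt0 //.
  by rewrite !mulNr.
by rewrite sublinearZ.
Qed.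

(** A linear functional below [slide q v] is below [q], and its value at [- v]
    is at most [- q v]. *)
Lemma hahn_banach_norming q v : sublinear q ->
  exists f : X -> R, [/\ scalar f, forall x, f x <= q x & f v = q v].
Proof.
move=> sq; have [f [sf fle fmin]] := minimal_sublinear (slide_sublinear v sq).
have fq x : f x <= q x by exact: le_trans (fle x) (slide_le_id _ _ sq).
have lf := minimal_sublinear_scalar sf fmin; exists f; split=> //.
apply/eqP; rewrite eq_le fq /=.
have := le_trans (fle (- v)) (slide_opp v sq).
have := lf (-1) v 0; rewrite addr0 scaleN1r sublinear0 //; lra.
Qed.

End HahnBanach.

(** * Directions orthogonal to finitely many vectors *)

Section InfiniteDimension.
Context {R : realType}.

Lemma scalarD (X : lmodType R) (f : X -> R) x y : scalar f ->
  f (x + y) = f x + f y.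
Proof. by move=> lf; have := lf 1 x y; rewrite scale1r mul1r. Qed.

Lemma scalarZ (X : lmodType R) (f : X -> R) a x : scalar f ->
  f (a *: x) = a * f x.
Proof.
move=> lf; have f0 : f 0 = 0.
  by have := lf (-1) 0 0; rewrite scaler0 addr0 mulN1r addNr.
by have := lf a x 0; rewrite f0 !addr0.
Qed.

Lemma linspan_setU1 (X : lmodType R) (B : set X) e y c :
  linspan B y -> linspan (e |` B) (y + c *: e).
Proof.
move=> [n [d [v [Bv ->]]]].
exists n.+1, (fun i => oapp d c (unlift ord_max i)),
  (fun i => oapp v e (unlift ord_max i)); split.
  by move=> i; case: unliftP => [j _|_] /=; [right; exact: Bv|left].
rewrite big_ord_recr /= unlift_none /=; congr (_ + _).
apply: eq_bigr => i _; suff -> : widen_ord (leqnSn n) i = lift ord_max i.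
  by rewrite liftK.
by apply: val_inj; rewrite /= /bump leqNgt ltn_ord.
Qed.

(** [n] functionals cut out a subspace of codimension at most [n]: a
    functional that does not vanish on the common kernel of the preceding ones
    costs one more spanning vector. *)
Lemma finite_codim_kernel (X : lmodType R) (f : nat -> X -> R) n :
  (forall i, scalar (f i)) ->
  exists2 B : set X, finite_set B & forall x, exists2 y, linspan B y &
    forall i, (i < n)%N -> f i x = f i y.
Proof.
move=> lf; elim: n => [|n [B finB IH]].
  exists set0 => // x; exists 0 => //.
  by exists 0%N, (fun=> 0), (fun=> 0); split=> [[]|]; rewrite ?big_ord0.
have [[e [e0 en]]|noe] :=
    pselect (exists e, (forall i, (i < n)%N -> f i e = 0) /\ f n e <> 0).
  exists (e |` B); first by rewrite finite_setU; split.
  move=> x; have [y By xy] := IH x.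
  exists (y + ((f n x - f n y) / f n e) *: e); first exact: linspan_setU1.
  move=> i; rewrite ltnS leq_eqVlt scalarD // scalarZ //.
  move=> /predU1P[->|i_n]; last by rewrite (e0 i i_n) mulr0 addr0 xy.
  by rewrite mulfVK; [rewrite addrC subrK|exact/eqP].
exists B => // x; have [y By xy] := IH x; exists y => // i.
rewrite ltnS leq_eqVlt => /predU1P[->|]; last exact: xy.
apply: contrapT => nxy; apply: noe; exists (x + (-1) *: y).
split=> [j jn|]; rewrite scalarD // scalarZ // mulN1r; first by rewrite xy // subrr.
by move/eqP; rewrite subr_eq0 => /eqP.
Qed.

Lemma common_kernel_neq0 (X : lmodType R) (f : nat -> X -> R) n :
  infinite_dimensional X -> (forall i, scalar (f i)) ->
  exists2 u, u != 0 & forall i, (i < n)%N -> f i u = 0.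
Proof.
move=> infX lf; apply: contrapT => nou; apply: infX.
have [B finB BX] := finite_codim_kernel n lf; exists B => //.
rewrite -subTset => x _; have [y By xy] := BX x.
suff -> : x = y by [].
apply/eqP; rewrite -subr_eq0; apply/negPn/negP => xy0; apply: nou.
exists (x - y) => // i i_n.
by rewrite -scaleN1r scalarD // scalarZ // xy // mulN1r subrr.
Qed.

(** Norming functionals of the [v i] have a common kernel vector [u], and
    moving along [u] does not change their values. *)
Lemma exists_orthogonal_direction (X : normedModType R) (v : nat -> X) n :
  infinite_dimensional X ->
  exists2 u : X, `|u| = 1 &
    forall i, (i < n)%N -> forall t : R, `|v i| <= `|v i + t *: u|.
Proof.
move=> infX.
have snorm : sublinear (fun x : X => `|x|).
  split=> [x y|t x t0]; first exact: ler_normD.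
  by rewrite normrZ gtr0_norm.
have [f fP] := choice (fun i => hahn_banach_norming (v i) snorm).
have lf i : scalar (f i) by have [] := fP i.
have [u u0 fu] := common_kernel_neq0 n infX lf.
exists (`|u|^-1 *: u).
  by rewrite normrZ normfV normr_id mulVf ?normr_eq0.
move=> i i_n t; have [_ fle fv] := fP i.
rewrite -fv scalerA (le_trans _ (fle _)) //.
by rewrite scalarD // scalarZ // fu // mulr0 addr0.
Qed.

End InfiniteDimension.

(** * A badly approximable point *)

Lemma lattice_separated (R : realType) (X : completeNormedModType R) (L : set X) :
  lattice L -> exists2 m : R, 0 < m & forall p, L p -> p != 0 -> m <= `|p|.
Proof.
move=> [[/set_mem L0 _] isoL _].
have [_ [V /nbhs_ballP[m /= m0 mV] VL]] : isolated L 0 by rewrite isoL.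
exists m => // p Lp p0; rewrite leNgt; apply/negP => pm.
suff : [set 0] p by move=> /= p0'; rewrite p0' eqxx in p0.
rewrite -VL; split=> //; apply: mV.
by rewrite -ball_normE /= sub0r normrN.
Qed.

Lemma lattice_subr_closed (R : realType) (X : completeNormedModType R) (L : set X) :
  lattice L -> forall x y, L x -> L y -> L (x - y).
Proof.
move=> [[_ LB] _ _] x y Lx Ly; apply: set_mem; apply: LB; exact: mem_set.
Qed.

(** The bound is the sum of the remaining increments, a geometric series of
    ratio [1 / 2]. *)
Lemma cvg_geometric_increments (R : realType) (X : completeNormedModType R)
    (S : nat -> X) (a : R) : 0 < a ->
  (forall k, `|S k.+1 - S k| <= a / 2 ^+ k) ->
  exists x, forall k, `|x - S k| <= 2 * a / 2 ^+ k.
Proof.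
move=> a0 Sa.
have inc k i : `|S (k + i)%N - S k| <= 2 * a / 2 ^+ k - 2 * a / 2 ^+ (k + i).
  elim: i => [|i IH]; first by rewrite addn0 !subrr normr0.
  have := ler_normD (S (k + i).+1 - S (k + i)%N) (S (k + i)%N - S k).
  rewrite addrA subrK addnS => /le_trans; apply.
  have := Sa (k + i)%N.
  have -> : 2 * a / 2 ^+ (k + i).+1 = a / 2 ^+ (k + i).
    by rewrite exprS invfM mulrACA divff ?mul1r.
  by move: IH; rewrite -[in 2 * a / 2 ^+ (k + i)]mulrA; lra.
have cS : cvgn (series (telescope S)).
  apply: normed_cvg; apply: (@series_le_cvg _ _ (geometric a (2^-1))) => [n|n|n|].
  - exact: normr_ge0.
  - by rewrite /= mulr_ge0 // ?exprn_ge0 ?invr_ge0 // ltW.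
  - by rewrite /= exprVn; exact: Sa.
  - by apply: is_cvg_geometric_series; rewrite gtr0_norm; lra.
pose x := S 0%N + limn (series (telescope S)); exists x => k.
have Sx : S n @[n --> \oo] --> x.
  by rewrite (funext (eq_sum_telescope S)); apply: cvgD => //; exact: cvg_cst.
have a0k : 0 <= 2 * a / 2 ^+ k by rewrite divr_ge0 ?exprn_ge0 // mulr_ge0 // ltW.
have Nx : `|S n - S k| @[n --> \oo] --> `|x - S k|.
  by apply: cvg_norm; apply: cvgB => //; exact: cvg_cst.
apply: (@closed_cvg _ _ _ _ _ (fun z => z <= 2 * a / 2 ^+ k) _ _ _ Nx).
  exact: closed_le.
near=> n; have kn : (k <= n)%N by near: n; exact: nbhs_infty_ge.
rewrite /= -(subnKC kn); apply: le_trans (inc _ _) _.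
by rewrite lerBlDr lerDl divr_ge0 ?exprn_ge0 // mulr_ge0 // ltW.
Unshelve. all: by end_near. Qed.

(** Two lattice points within [m / 2] of the same point would differ by less
    than [m].  So each [q < n] contributes at most one vector [q S - p] of norm
    less than [m / 2], although [L] is infinite. *)
Lemma exists_lengthening_direction (R : realType)
    (X : completeNormedModType R) (L : set X) (m : R) (S : X) (n : nat) :
  infinite_dimensional X ->
  (forall x y, L x -> L y -> L (x - y)) ->
  (forall p, L p -> p != 0 -> m <= `|p|) ->
  exists u : X, `|u| = 1 /\ forall q p, (q < n)%N -> L p ->
    `|q%:R *: S - p| < m / 2 ->
    forall t : R, `|q%:R *: S - p| <= `|q%:R *: S - p + t *: u|.
Proof.
move=> infX LB Lm.
have near_unique x p p' : L p -> L p' -> `|x - p| < m / 2 ->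
    `|x - p'| < m / 2 -> p = p'.
  move=> Lp Lp' xp xp'; apply/eqP; rewrite -subr_eq0; apply/negPn/negP => pp'.
  have := Lm _ (LB _ _ Lp Lp') pp'.
  have := ler_normB (x - p') (x - p).
  by rewrite opprB addrC subrKA; lra.
have /choice[P PP] (q : nat) : exists p,
    (exists2 p, L p & `|q%:R *: S - p| < m / 2) ->
    L p /\ `|q%:R *: S - p| < m / 2.
  have [[p Lp qSp]|nop] := pselect (exists2 p, L p & `|q%:R *: S - p| < m / 2).
    by exists p.
  by exists 0 => /nop.
have [u u1 uP] := exists_orthogonal_direction (fun q => q%:R *: S - P q) n infX.
exists u; split=> // q p qn Lp qSp t.
have [LP qSP] := PP q (ex_intro2 _ _ p Lp qSp).
by rewrite (near_unique _ _ _ Lp LP qSp qSP); exact: uP.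
Qed.

(** With [k] the integer part of the binary logarithm of [q], the vectors
    [q S_j - p] with [j >= k] are followed until one of them has norm at least
    [m / 2]; as long as this does not happen their norms increase, starting from
    at least [a / 2] after step [k]. *)
Lemma exists_badly_approximable (R : realType) (X : completeNormedModType R)
    (L : set X) :
  infinite_dimensional X -> lattice L ->
  exists (x : X) (c : R), 0 < c /\ forall (q : nat) (p : X), (0 < q)%N -> L p ->
    c <= `|q%:R *: x - p|.
Proof.
move=> infX latL.
have [m m0 Lm] := lattice_separated latL.
have LB := lattice_subr_closed latL.
(* [4 a], the bound for the later displacements, has to be less than [m / 2] *)
pose a := m / 16.
have a0 : 0 < a by rewrite divr_gt0.
have [U UP] := choice (fun kS : nat * X =>
  exists_lengthening_direction kS.2 (2 ^ kS.1.+1)%N infX LB Lm).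
pose S := fix S k := if k is k'.+1 then S k' + (a / 2 ^+ k') *: U (k', S k') else 0.
have U1 k y : `|U (k, y)| = 1 by case: (UP (k, y)).
have step k q p : (q < 2 ^ k.+1)%N -> L p -> `|q%:R *: S k - p| < m / 2 ->
    forall t : R, `|q%:R *: S k - p| <= `|q%:R *: S k - p + t *: U (k, S k)|.
  by case: (UP (k, S k)) => _; exact.
have SE k q p : q%:R *: S k.+1 - p =
    q%:R *: S k - p + (q%:R * (a / 2 ^+ k)) *: U (k, S k).
  by rewrite /= scalerDr scalerA addrAC.
have [k|x xS] := cvg_geometric_increments (S := S) a0.
  by rewrite /= addrC addKr normrZ U1 mulr1 ger0_norm // divr_ge0 ?exprn_ge0 // ltW.
exists x, (a / 4); split=> [|q p q0 Lp]; first by rewrite divr_gt0.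
set k := trunc_log 2 q.
have /andP[kq qk] : (2 ^ k <= q < 2 ^ k.+1)%N by exact: trunc_log_bounds.
have qk2 i : q%:R / 2 ^+ (k + i) <= 2 / 2 ^+ i :> R.
  rewrite exprD invfM mulrA ler_pM2r ?invr_gt0 ?exprn_gt0 //.
  by rewrite ler_pdivrMr ?exprn_gt0 // -exprS -natrX ler_nat ltnW.
(* the distance still to be travelled by [q S_(k+i)] on its way to [q x] *)
have tail i : `|q%:R *: S (k + i)%N - p| - `|q%:R *: x - p| <= 4 * a / 2 ^+ i.
  have := lerB_dist (q%:R *: S (k + i)%N - p) (q%:R *: x - p).
  rewrite opprB addrA subrK -scalerBr normrZ normr_nat [`|_ - x|]distrC.
  move=> /le_trans; apply.
  apply: le_trans (ler_wpM2l (ler0n _ q) (xS _)) _.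
  have := ler_wpM2l (mulr_ge0 (ler0n R 2) (ltW a0)) (qk2 i).
  by rewrite mulrCA mulrA; lra.
have [[i far]|near] := pselect (exists i, m / 2 <= `|q%:R *: S (k + i)%N - p|).
  have := tail i; have : 4 * a / 2 ^+ i <= 4 * a.
    by rewrite ler_pdivrMr ?exprn_gt0 // ler_peMr ?exprn_ege1 ?ler1n //; lra.
  by rewrite /a in a0 *; lra.
have lt_near i : `|q%:R *: S (k + i)%N - p| < m / 2.
  by rewrite ltNge; apply/negP => far; apply: near; exists i.
have qki i : (q < 2 ^ (k + i).+1)%N.
  by apply: leq_trans qk _; rewrite leq_exp2l // ltnS leq_addr.
have mono i : `|q%:R *: S (k + i)%N - p| <= `|q%:R *: S (k + i).+1 - p|.
  by rewrite SE; apply: step.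
have gain : a / 2 <= `|q%:R *: S k.+1 - p|.
  have := mono 0%N; rewrite addn0.
  have := ler_normB (q%:R *: S k.+1 - p) (q%:R *: S k - p).
  rewrite {1}SE addrC addKr normrZ U1 mulr1 ger0_norm; last first.
    by rewrite mulr_ge0 // divr_ge0 ?exprn_ge0 // ltW.
  (* the step has norm at least [a] after multiplication by [q >= 2^k] *)
  have : a <= q%:R * (a / 2 ^+ k).
    rewrite mulrCA ler_peMr ?(ltW a0) // ler_pdivlMr ?exprn_gt0 // mul1r.
    by rewrite -natrX ler_nat.
  lra.
have gains i : a / 2 <= `|q%:R *: S (k + i).+1 - p|.
  elim: i => [|i IH]; first by rewrite addn0.
  by apply: le_trans IH _; rewrite -addnS; exact: mono.
(* The tail at [S_k] may exceed the gain [a / 2], but norms do not decrease in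
   between: five steps later the tail is only [a / 8]. *)
have := tail 5%N; have := gains 4%N; rewrite -addnS.
have -> : 2 ^+ 5 = 32 :> R by rewrite -natrX.
lra.
Qed.

(** * Rational approximation and heights *)

Section Heights.
Context {R : realType} {X : completeNormedModType R}.
Implicit Type L : set X.

Lemma std_heightP L r : rational_points L r ->
  [/\ (0 < std_height L r)%N, L ((std_height L r)%:R *: r) &
    forall n, (0 < n)%N -> L (n%:R *: r) -> (std_height L r <= n)%N].
Proof.
move=> [p [q [Lp q0 rE]]].
pose P n := `[< (0 < n)%N /\ L (n%:R *: r) >].
have Pq : exists n, P n.
  exists q; apply/asboolP; split=> //.
  by rewrite rE scalerA divff ?scale1r // pnatr_eq0 -lt0n.
apply: (@getPex _ (fun q : nat => [/\ (0 < q)%N, L (q%:R *: r)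
     & forall m : nat, (0 < m)%N -> L (m%:R *: r) -> (q <= m)%N])).
case: (ex_minnP Pq) => n /asboolP[n0 Ln] nmin; exists n; split=> // i i0 Li.
by apply: nmin; apply/asboolP.
Qed.

Lemma codiam_approx L (eps : R) (x : X) : cobounded L -> 0 < eps ->
  exists2 p, L p & `|x - p| <= fine (codiam L) + eps.
Proof.
move=> cobL eps0.
have dx : (edist_inf L x <= codiam L)%E by apply: ereal_sup_ubound; exists x.
have fin : codiam L \is a fin_num.
  by rewrite ge0_fin_numE //; apply: le_trans dx; exact: edist_inf_ge0.
have : (edist_inf L x < (fine (codiam L) + eps)%:E)%E.
  by rewrite EFinD fineK //; apply: le_lt_trans dx _; rewrite lteDl // lte_fin.
move=> /ereal_inf_lt[_ [p Lp <-]] /edist_lt_ball.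
by rewrite -ball_normE /= => /ltW; exists p.
Qed.

Lemma rational_approx L (eps : R) (x : X) (q : nat) :
  cobounded L -> 0 < eps -> (0 < q)%N ->
  exists2 p, L p & `|x - q%:R^-1 *: p| <= (fine (codiam L) + eps) / q%:R.
Proof.
move=> cobL eps0 q0; have [p Lp xp] := codiam_approx (q%:R *: x) cobL eps0.
exists p => //; have qn0 : 0 < q%:R :> R by rewrite ltr0n.
rewrite ler_pdivlMr // -[X in _ * X]gtr0_norm // mulrC -normrZ scalerBr.
by rewrite scalerA divff ?scale1r // gt_eqF.
Qed.

Lemma inv_pos_fun : pos_fun (fun q : R => q^-1).
Proof. by move=> t t0; rewrite invr_gt0. Qed.

(** The height of [p / q] may be smaller than [q], which only weakens the
    inequality to be proved, since [1 / q] is decreasing. *)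
Lemma inv_uniformly_dirichlet L : cobounded L ->
  uniformly_dirichlet (rational_points L) (std_height L) (fun q : R => q^-1).
Proof.
move=> cobL; split; first exact: inv_pos_fun.
have C0 : 0 < fine (codiam L) + 1.
  apply: ltr_wpDl => //; apply: fine_ge0; apply: le_trans (edist_inf_ge0 L 0) _.
  by apply: ereal_sup_ubound; exists 0.
exists (fine (codiam L) + 1) => // x.
have /choice[P PP] (n : nat) : exists p, L p /\
    `|x - n.+1%:R^-1 *: p| <= (fine (codiam L) + 1) / n.+1%:R.
  by have [p Lp xp] := rational_approx x cobL ltr01 (ltn0Sn n); exists p.
pose r n := n.+1%:R^-1 *: P n.
have rQ n : rational_points L (r n).
  by have [LP _] := PP n; exists (P n), n.+1; split.
exists r; split=> [//||n].
  apply/cvgrPdist_lt => e e0; near=> n.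
  apply: le_lt_trans (PP n).2 _; rewrite mulrC -ltr_pdivlMr //.
  apply: le_lt_trans (ler_norm _) _; near: n.
  by apply: (cvgr0_norm_lt _ cvg_harmonic); rewrite divr_gt0.
have [LP xP] := PP n; apply: le_trans xP _.
have [H0 _ Hmin] := std_heightP (rQ n).
rewrite ler_pM2l // lef_pV2 ?posrE ?ltr0n // ler_nat; apply: Hmin => //.
by rewrite /r scalerA divff ?scale1r // pnatr_eq0.
Unshelve. all: by end_near. Qed.

(** The hypothesis is used at the reduced denominator [h] of [r], where
    [h r] is a lattice point. *)
Lemma badly_approximable_height L (x : X) (c : R) r :
  (forall (q : nat) (p : X), (0 < q)%N -> L p -> c <= `|q%:R *: x - p|) ->
  rational_points L r -> c <= (std_height L r)%:R * `|x - r|.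
Proof.
move=> xbad Qr; have [H0 LH _] := std_heightP Qr.
by have := xbad _ _ H0 LH; rewrite -scalerBr normrZ normr_nat.
Qed.

(** A single good term [r n] of the sequence suffices: far enough along, it is so
    close to [x] that its height exceeds the threshold beyond which
    [phi t / t^-1 < c / C]. *)
Lemma inv_optimal L : infinite_dimensional X -> lattice L -> cobounded L ->
  optimal (rational_points L) (std_height L) (fun q : R => q^-1).
Proof.
move=> infX latL cobL; split.
  have [pos [C C0 CP]] := inv_uniformly_dirichlet cobL.
  by split=> // x; exists C.
move=> [phi [phi_pos phiD] phi0].
have [x [c [c0 xbad]]] := exists_badly_approximable infX latL.
have [C C0 [r [rQ rx xr]]] := phiD x.
have : \forall t \near +oo, `|phi t / t^-1| < c / C.
  by apply: (cvgr0_norm_lt _ phi0); rewrite divr_gt0.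
move=> [M [_ MP]].
(* [M] may be negative, and [c / M'] needs a positive denominator *)
pose M' := Num.max M 1.
have M'0 : 0 < M' by rewrite lt_max ltr01 orbT.
have : \forall n \near \oo, `|x - r n| < c / M'.
  by move/cvgrPdist_lt : rx; apply; rewrite divr_gt0.
move=> [n _ /(_ n (leqnn n)) /= xrn].
set h : R := (std_height L (r n))%:R.
have h0 : 0 < h by rewrite ltr0n; have [] := std_heightP (rQ n).
have ch : c <= h * `|x - r n| by exact: badly_approximable_height.
have Mh : M < h.
  have M'h : M' < h.
    rewrite -(ltr_pM2l c0); apply: le_lt_trans (_ : h * `|x - r n| * M' < _).
      by rewrite ler_wpM2r // ltW.
    by rewrite -mulrA [c * h]mulrC ltr_pM2l // -ltr_pdivlMr.
  by apply: le_lt_trans M'h; rewrite le_max lexx.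
have := MP h Mh; rewrite /= invrK ltr_pdivlMr //.
apply/negP; rewrite -leNgt; apply: le_trans ch _.
rewrite ger0_norm; last by rewrite mulr_ge0 ?ltW ?phi_pos.
by rewrite [phi h * h]mulrC -mulrA ler_pM2l // [phi h * C]mulrC; exact: xr.
Qed.

End Heights.

Theorem theorem4p5 (R : realType) (X : completeNormedModType R)
    (L : set X) (infX : infinite_dimensional X)
    (latL : lattice L) (cobL : cobounded L) (eps : R) (eps_gt0 : 0 < eps) :
  [/\ (forall (x : X) (q : nat), (0 < q)%N ->
         exists2 p : X, L p &
           `|x - q%:R^-1 *: p| <= (fine (codiam L) + eps) / q%:R),
      uniformly_dirichlet (rational_points L) (std_height L) (fun q : R => q^-1)
    & optimal (rational_points L) (std_height L) (fun q : R => q^-1)].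
Proof.
split.
- by move=> x q q0; exact: rational_approx.
- exact: inv_uniformly_dirichlet.
- exact: inv_optimal.
Qed.
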